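(* Let $\beta>1$. For any $Z\subset S_\beta$, the Hausdorff dimension of $Z$ in $(S_\beta,d_\beta)$ is equal to the Hausdorff dimension of its natural projection in $[0,1]$, i.e., $$\dim_H(Z,d_\beta)=\dim_H\pi_\beta(Z).$$
   Context: Let $\beta>1$ and $\mathbb{N}=\{1,2,3,\dots\}$. The $\beta$-transformation $T_\beta:[0,1]\to[0,1]$ is $T_\beta(x):=\beta x-\lfloor\beta x\rfloor$. For $x\in[0,1]$ and $n\in\mathbb{N}$ put $\epsilon_n(x,\beta):=\lfloor\beta T_\beta^{n-1}(x)\rfloor$; the sequence $\epsilon(x,\beta)=\epsilon_1(x,\beta)\epsilon_2(x,\beta)\cdots$ is the (greedy) $\beta$-expansion of $x$, and $x=\sum_{n\ge1}\epsilon_n(x,\beta)\beta^{-n}$. Let $\mathcal{A}_\beta:=\{0,1,\dots,\lceil\beta\rceil-1\}$, where $\lceil\beta\rceil$ is the smallest integer no less than $\beta$. On $\mathcal{A}_\beta^{\mathbb{N}}$ use the metric $d_\beta(w,v):=\beta^{-\inf\{k\ge0:\,w_{k+1}\ne v_{k+1}\}}$ (equal to $0$ when $w=v$). A sequence $w\in\mathcal{A}_\beta^{\mathbb{N}}$ is admissible if there is $x\in[0,1)$ with $\epsilon_i(x,\beta)=w_i$ for all $i\in\mathbb{N}$. $\Sigma_\beta$ is the set of all admissible sequences and $S_\beta$ is its closure in $(\mathcal{A}_\beta^{\mathbb{N}},d_\beta)$. The natural projection $\pi_\beta:S_\beta\to[0,1]$ is $\pi_\beta(w):=\sum_{n\ge1}w_n\beta^{-n}$.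 For a metric space $(X,d)$, $A\subset X$, $s\ge0$, $\delta>0$, let $\mathcal{H}^s_\delta(A,d):=\inf\{\sum_{i}|U_i|^s: A\subset\bigcup_{i=1}^\infty U_i,\ |U_i|\le\delta\text{ for all } i\}$, where $|U|$ is the diameter of $U$, let $\mathcal{H}^s(A,d):=\lim_{\delta\to0}\mathcal{H}^s_\delta(A,d)$, and $\dim_H(A,d):=\sup\{s\ge0:\mathcal{H}^s(A,d)=\infty\}$, with $\sup\emptyset:=0$. For subsets of $\mathbb{R}$ with the usual metric one writes $\dim_H A$. *)

(* Defs.v *)
From HB Require Import structures.
From mathcomp Require Import all_boot all_order all_algebra.
From mathcomp Require Import all_classical all_reals all_analysis.

Set Implicit Arguments.
Unset Strict Implicit.
Unset Printing Implicit Defensive.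

Import Order.TTheory GRing.Theory Num.Theory.
Import numFieldNormedType.Exports.

Local Open Scope classical_set_scope.
Local Open Scope ring_scope.

(* The library equips a subset of a metric space, seen as a type, with the
   induced pseudometric; the following upgrades it to the induced metric. *)
Section subset_metric.
Context {R : realType} {T : metricType R} (A : set T).

Let sub_mdist (x y : A) : R := mdist (val x) (val y).

Let sub_mdist_ge0 (x y : A) : 0 <= sub_mdist x y.
Proof. exact: mdist_ge0. Qed.

Let sub_mdist_positivity (x y : A) : sub_mdist x y = 0 -> x = y.
Proof. by move=> /mdist_positivity /val_inj. Qed.

Let sub_ballEmdist (x : A) d : ball x d = [set y | sub_mdist x y < d].
Proof.
apply/seteqP; split=> y; rewrite /sub_mdist/=.
  by rewrite -initial_ballE/= ballEmdist.
by rewrite /ball/= /initial_ball/= ballEmdist.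
Qed.

HB.instance Definition _ := PseudoMetric_isMetric.Build R (set_type A)
  sub_mdist_ge0 sub_mdist_positivity sub_ballEmdist.

End subset_metric.

Section hausdorff.
Context {R : realType} {X : metricType R}.
Implicit Types (A U : set X) (s delta : R).
Local Open Scope ereal_scope.

(* maxe 0 gives the empty set diameter 0. *)
Definition diam U : \bar R :=
  maxe 0 (ereal_sup [set (mdist x y)%:E | x in U & y in U]).

(* |U|^s, with the usual convention at s = 0 that the empty set contributes 0
   and every other set 1 (0 `^ 0 = 1), so that H^0 is the counting measure. *)
Definition diam_pow s U : \bar R :=
  if U == set0 then 0 else poweR (diam U) s.

Definition hausdorff_content s delta A : \bar R :=
  ereal_inf [set \sum_(0 <= i <oo) diam_pow s (U i) | U in
    [set U : nat -> set X |
      A `<=` \bigcup_i U i /\ forall i, diam (U i) <= delta%:E]].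

Definition hausdorff_measure s A : \bar R :=
  lim (hausdorff_content s delta A @[delta --> 0^'+]).

(* ereal_sup set0 = -oo: maxe 0 implements sup set0 := 0. *)
Definition hausdorff_dim A : \bar R :=
  maxe 0 (ereal_sup
    [set s%:E | s in [set s : R | (0 <= s)%R /\ hausdorff_measure s A = +oo]]).

End hausdorff.

Section beta_expansion.
Context {R : realType}.

Definition beta_transformation (beta x : R) : R :=
  beta * x - (Num.floor (beta * x))%:~R.

(* Sequences are indexed from 0: [beta_digit beta x n] is epsilon_(n+1). *)
Definition beta_digit (beta x : R) (n : nat) : int :=
  Num.floor (beta * iter n (beta_transformation beta) x).

(* The type of all digit sequences; the proof of 1 < beta is a parameter so that
   the type can carry the metric, which is one only for such beta. *)
Definition digit_seq (beta : R) (beta_gt1 : 1 < beta) : Type :=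
  nat -> 'I_`|Num.ceil beta|%N.

Section digit_seq_metric.
Context (beta : R) (beta_gt1 : 1 < beta).
Local Notation digit_seq := (digit_seq beta_gt1).
Implicit Types w v u : digit_seq.

(* w k is the digit w_(k+1) of the mathematical sequence. *)
Definition digit_dist w v : R :=
  match pselect (exists k, w k != v k) with
  | left neq_wv => beta ^- ex_minn neq_wv
  | right _ => 0
  end.

Let digit_distP w v n : reflect (forall k, (k < n)%N -> w k = v k)
  (digit_dist w v <= beta ^- n).
Proof.
have b0 : 0 < beta by apply: lt_trans beta_gt1.
rewrite /digit_dist; case: pselect => [ex|nex].
  case: ex_minnP => m wvm min_m.
  rewrite lef_pV2 ?posrE ?exprn_gt0// ler_eXn2l//.
  apply: (iffP idP) => [nm k kn|].
    by apply/eqP/negPn/negP => /min_m; rewrite leqNgt (leq_trans kn).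
  by move=> eq_wv; rewrite leqNgt; apply/negP => /eq_wv/eqP; apply/negP.
rewrite invr_ge0 exprn_ge0 ?ltW//; left => k _.
by apply/eqP/negPn/negP => wvk; apply: nex; exists k.
Qed.

Let digit_distxx w : digit_dist w w = 0.
Proof.
rewrite /digit_dist; case: pselect => // ex; exfalso.
by have [k /eqP] := ex.
Qed.

Let digit_dist_positivity w v : digit_dist w v = 0 -> w = v.
Proof.
move=> wv0; apply/funext => k.
have b0 : 0 < beta by apply: lt_trans beta_gt1.
have /digit_distP : digit_dist w v <= beta ^- k.+1.
  by rewrite wv0 invr_ge0 exprn_ge0// ltW.
exact.
Qed.

Let digit_dist_cases w v :
  digit_dist w v = 0 \/ exists n, digit_dist w v = beta ^- n.
Proof.
by rewrite /digit_dist; case: pselect => [ex|_]; [right; eexists|left].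
Qed.

Let digit_dist_ge0 w v : 0 <= digit_dist w v.
Proof.
have b0 : 0 < beta by apply: lt_trans beta_gt1.
by case: (digit_dist_cases w v) => [->//|[n ->]]; rewrite invr_ge0 exprn_ge0// ltW.
Qed.

Let digit_dist_sym w v : digit_dist w v = digit_dist v w.
Proof.
have le u1 u2 : digit_dist u1 u2 <= digit_dist u2 u1.
  case: (digit_dist_cases u2 u1) => [h|[n h]].
    by rewrite (digit_dist_positivity h) digit_distxx.
  have /digit_distP eq21 : digit_dist u2 u1 <= beta ^- n by rewrite h.
  by rewrite h; apply/digit_distP => k /eq21.
by apply/eqP; rewrite eq_le !le.
Qed.

Let digit_dist_triangle v w u :
  digit_dist w u <= digit_dist w v + digit_dist v u.
Proof.
have [h|[n h]] := digit_dist_cases w v.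
  by rewrite (digit_dist_positivity h) digit_distxx add0r.
have [h'|[m h']] := digit_dist_cases v u.
  by rewrite (digit_dist_positivity h') digit_distxx addr0.
have /digit_distP eqwv : digit_dist w v <= beta ^- n by rewrite h.
have /digit_distP eqvu : digit_dist v u <= beta ^- m by rewrite h'.
have [nm|mn] := leqP n m.
  apply: le_trans (_ : digit_dist w v <= _); last by rewrite lerDl digit_dist_ge0.
  rewrite h; apply/digit_distP => k kn.
  by rewrite eqwv// eqvu// (leq_trans kn).
apply: le_trans (_ : digit_dist v u <= _); last by rewrite lerDr digit_dist_ge0.
rewrite h'; apply/digit_distP => k km.
by rewrite eqwv ?eqvu// (ltn_trans km).
Qed.

HB.instance Definition _ := Choice.copy digit_seq (nat -> 'I_`|Num.ceil beta|%N).

HB.instance Definition _ := isMetric.Build R digit_seq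
  digit_distxx digit_dist_positivity digit_dist_sym digit_dist_triangle.

End digit_seq_metric.

End beta_expansion.

Definition Sigma_beta {R : realType} {beta : R} (beta_gt1 : 1 < beta) :
    set (digit_seq beta_gt1) :=
  [set w | exists x : R, 0 <= x < 1 /\
    forall i : nat, beta_digit beta x i = (w i : nat)%:Z].
Arguments Sigma_beta {R beta} beta_gt1.

Definition S_beta {R : realType} {beta : R} (beta_gt1 : 1 < beta) :
    set (digit_seq beta_gt1) :=
  closure (Sigma_beta beta_gt1).
Arguments S_beta {R beta} beta_gt1.

(* Valued in R^o, which carries the usual metric |y - x| in the library. *)
Definition pi_beta {R : realType} {beta : R} (beta_gt1 : 1 < beta)
    (w : S_beta beta_gt1) : R^o :=
  limn (series (fun n => (val w n : nat)%:R * beta ^- n.+1 : R)).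
Arguments pi_beta {R beta} beta_gt1 w.

(* Main.v *)
Require Import Defs.
From HB Require Import structures.
From mathcomp Require Import all_boot all_order all_algebra.
From mathcomp Require Import all_classical all_reals all_analysis.
From mathcomp Require Import ring lra.

Import Order.TTheory GRing.Theory Num.Theory.
Import numFieldNormedType.Exports.

Local Open Scope classical_set_scope.
Local Open Scope ring_scope.

(** Both inequalities rest on comparing covers.

    Two sequences that share their first [n] digits have projections at distance
    at most a constant times [beta ^- n], so the projection is Lipschitz, and a
    Lipschitz map does not increase the dimension
    ([hausdorff_dim_lipschitz_image]).

    The projection has no Lipschitz inverse: it is not injective, and a cylinder
    of order [n] can be much shorter than [beta ^- n], so that a set of diameter
    [beta ^- n] may meet many cylinders of order [n]. The point is that it meets
    at most a constant times [n + 1] of them ([pi_beta_fibres]). For points of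
    [0, 1[ this is proved by induction on [n], reading the first digit
    ([beta_digit_words]): a window of length [beta ^- n] contains at most one
    point where this digit changes, the points on its left behave as a window at
    order [n - 1], and those on its right all have the same [n]-prefix. The count
    thus grows by at most one at each order. It extends to the closure of the
    admissible sequences because each element of the closure has the [n]-prefix
    of a point of [0, 1[ at distance at most a constant times [beta ^- n] from
    its projection ([S_beta_approx]).

    A cover of the image by sets of diameters about [beta ^- n_i] therefore lifts
    to a cover by cylinders in which each set is replaced by a constant times
    [n_i + 1] sets of diameter at most [beta ^- n_i]. When [s < t], the factor
    [n_i + 1] is absorbed by [beta ^ (n_i * (t - s))], so the [t]-dimensional
    content of the set is at most a constant times the [s]-dimensional content of
    its image ([hausdorff_content_fibres]), and the dimension of the set is at
    most that of its image ([hausdorff_dim_fibres]). *)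

(** * Hausdorff contents, measures and dimension *)

Section hausdorff_basics.
Context {R : realType} {X : metricType R}.
Implicit Types (A U : set X) (s t d e : R).
Local Open Scope ereal_scope.

Lemma diam_ge0 U : 0 <= diam U.
Proof. by rewrite /diam le_max lexx. Qed.

Lemma diam0 : diam (set0 : set X) = 0.
Proof.
apply/eqP; rewrite eq_le diam_ge0 andbT /diam ge_max lexx/=.
by apply: ge_ereal_sup => _ /= [x []].
Qed.

Lemma mdist_le_diam U x y : U x -> U y -> (mdist x y)%:E <= diam U.
Proof.
move=> Ux Uy; rewrite /diam le_max; apply/orP; right.
by apply: ereal_sup_ge; exists (mdist x y)%:E => //; exists x => //; exists y.
Qed.

Lemma diam_le U (d : \bar R) : 0 <= d ->
  (forall x y, U x -> U y -> (mdist x y)%:E <= d) -> diam U <= d.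
Proof.
move=> d0 Ud; rewrite /diam ge_max d0/=.
by apply: ge_ereal_sup => _ /= [x Ux [y Uy <-]]; exact: Ud.
Qed.

Lemma diam_pow_ge0 s U : 0 <= diam_pow s U.
Proof. by rewrite /diam_pow; case: ifP => // _; exact: poweR_ge0. Qed.

Lemma diam_pow0 s : diam_pow s (set0 : set X) = 0.
Proof. by rewrite /diam_pow eqxx. Qed.

Lemma diam_pow_le s U d : (0 <= s)%R -> diam U <= d%:E ->
  diam_pow s U <= (d `^ s)%:E.
Proof.
move=> s0 Ud; rewrite /diam_pow; case: ifP => _; first by rewrite lee_fin powR_ge0.
rewrite -poweR_EFin; apply: gt0_ler_poweR => //; rewrite in_itv/= leey andbT.
- exact: diam_ge0.
- exact: le_trans (diam_ge0 U) Ud.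
Qed.

(** A doubly indexed cover bounds the content, because its members can be listed
    in a single sequence. *)
Lemma hausdorff_content_le_double s d A (V : nat -> nat -> set X) :
  A `<=` \bigcup_i \bigcup_j V i j -> (forall i j, diam (V i j) <= d%:E) ->
  hausdorff_content s d A <=
    \sum_(0 <= i <oo) \sum_(0 <= j <oo) diam_pow s (V i j).
Proof.
move=> AV Vd; have /card_esym/ppcard_eqP[f] := card_nat2.
apply: ereal_inf_le; exists (\sum_(0 <= k <oo) diam_pow s (V (f k).1 (f k).2)).
  exists (fun k => V (f k).1 (f k).2) => //; split => [x /AV[i _ [j _ Vx]]|k].
    by exists (f^-1%FUN (i, j)) => //=; rewrite invK ?inE.
  exact: Vd.
rewrite nneseries_esumT; last by move=> k; exact: diam_pow_ge0.
rewrite -(@reindex_esum _ _ _ setT setT f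
  (fun k => diam_pow s (V k.1 k.2))); last exact: bij.
rewrite nneseries_esumT; last first.
  by move=> i; apply: nneseries_ge0 => j _ _; exact: diam_pow_ge0.
rewrite [leRHS](@eq_esum _ _ _ _
  (fun i => \esum_(j in setT) diam_pow s (V i j))); last first.
  by move=> i _; rewrite nneseries_esumT// => j; exact: diam_pow_ge0.
rewrite esum_esum; last by move=> i j _ _; exact: diam_pow_ge0.
by rewrite (_ : setT `*`` _ = setT)//; apply/seteqP; split.
Qed.

Lemma hausdorff_content_nonincreasing s A d e : (d <= e)%R ->
  hausdorff_content s e A <= hausdorff_content s d A.
Proof.
move=> de; apply: ereal_inf_le_tmp => _ /= [U [AU Ud] <-]; exists U => //.
by split => // i; apply: le_trans (Ud i) _; rewrite lee_fin.
Qed.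

(** The limit defining the Hausdorff measure is a supremum. *)
Lemma hausdorff_measureE s A : hausdorff_measure s A =
  ereal_sup [set hausdorff_content s d A | d in [set d | (0 < d)%R]].
Proof.
rewrite /hausdorff_measure; apply/cvg_lim => //.
rewrite (_ : [set d | (0 < d)%R] = [set` Interval (BRight 0%R) +oo%O]).
  apply: nonincreasing_at_right_cvge => // d e _ _.
  exact: hausdorff_content_nonincreasing.
by apply/seteqP; split => d /=; rewrite in_itv/= andbT.
Qed.

Lemma hausdorff_content_le_measure s A d : (0 < d)%R ->
  hausdorff_content s d A <= hausdorff_measure s A.
Proof. by move=> d0; rewrite hausdorff_measureE; apply: ereal_sup_ubound; exists d. Qed.

Lemma hausdorff_measure_le s A (M : \bar R) :
  (forall d, (0 < d)%R -> hausdorff_content s d A <= M) ->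
  hausdorff_measure s A <= M.
Proof.
by move=> AM; rewrite hausdorff_measureE; apply: ge_ereal_sup => _ /= [d d0 <-]; exact: AM.
Qed.

Lemma hausdorff_dim_ge0 A : 0 <= hausdorff_dim A.
Proof. by rewrite /hausdorff_dim le_max lexx. Qed.

Lemma le_hausdorff_dim A s : (0 <= s)%R -> hausdorff_measure s A = +oo ->
  s%:E <= hausdorff_dim A.
Proof.
move=> s0 As; rewrite /hausdorff_dim le_max; apply/orP; right.
by apply: ereal_sup_ge; exists s%:E => //; exists s.
Qed.

Lemma hausdorff_dim_le A (M : \bar R) : 0 <= M ->
  (forall s, (0 <= s)%R -> hausdorff_measure s A = +oo -> s%:E <= M) ->
  hausdorff_dim A <= M.
Proof.
move=> M0 AM; rewrite /hausdorff_dim ge_max M0/=.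
by apply: ge_ereal_sup => _ /= [s [s0 sA] <-]; exact: AM.
Qed.

End hausdorff_basics.

(** * Lipschitz images *)

Lemma pinfty_le_pmul {R : realType} (c : R) (x : \bar R) : 0 < c ->
  (+oo <= c%:E * x)%E -> x = +oo%E.
Proof.
move=> c0; rewrite leye_eq => /eqP; case: x => [r||] //.
by rewrite mulrNy gtr0_sg// mul1e.
Qed.

Section lipschitz.
Context {R : realType} {X Y : metricType R} (f : X -> Y) (L : R).
Context (L_gt0 : 0 < L)
  (f_lipschitz : forall x y, mdist (f x) (f y) <= L * mdist x y).
Implicit Types (A U : set X) (s d : R).
Local Open Scope ereal_scope.

Lemma diam_lipschitz_image U : diam (f @` U) <= L%:E * diam U.
Proof.
have L0 : 0 <= L%:E by rewrite lee_fin ltW.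
apply: diam_le => [|_ _ [x Ux <-] [y Uy <-]]; first exact: mule_ge0 (diam_ge0 _).
apply: (@le_trans _ _ (L * mdist x y)%:E); first by rewrite lee_fin f_lipschitz.
by rewrite EFinM lee_pmul2l// mdist_le_diam.
Qed.

Lemma hausdorff_content_lipschitz_image A s d : (0 <= s)%R ->
  hausdorff_content s (L * d) (f @` A) <= (L `^ s)%:E * hausdorff_content s d A.
Proof.
move=> s0; have Ls0 : (0 < L `^ s)%R by exact: powR_gt0.
rewrite -lee_pdivrMl//; apply: le_ereal_inf_tmp => _ /= [U [AU Ud] <-].
rewrite lee_pdivrMl// -nneseriesZl; last by move=> i _; exact: diam_pow_ge0.
apply: ereal_inf_le.
exists (\sum_(0 <= i <oo) diam_pow s (f @` U i)).
  exists (fun i => f @` U i) => //; split => [_ [x /AU[i _ Ux] <-]|i].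
    by exists i => //; exists x.
  by apply: le_trans (diam_lipschitz_image _) _; rewrite EFinM lee_pmul2l.
apply: lee_nneseries => [i _ _|i _]; first exact: diam_pow_ge0.
have [->|U0] := eqVneq (U i) set0; first by rewrite image_set0 !diam_pow0 mule0.
have fU0 : f @` U i != set0 by have /set0P[x Ux] := U0; apply/set0P; exists (f x), x.
rewrite /diam_pow (negbTE U0) (negbTE fU0).
rewrite -poweR_EFin -poweRM ?diam_ge0 ?lee_fin ?(ltW L_gt0)//.
apply: gt0_ler_poweR; rewrite ?in_itv/= ?leey ?andbT ?diam_ge0//.
- by apply: mule_ge0 (diam_ge0 _); rewrite lee_fin ltW.
- exact: diam_lipschitz_image.
Qed.

Lemma hausdorff_dim_lipschitz_image A : hausdorff_dim (f @` A) <= hausdorff_dim A.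
Proof.
apply: hausdorff_dim_le (hausdorff_dim_ge0 A) _ => s s0 fAs.
apply: le_hausdorff_dim => //; have Ls0 : (0 < L `^ s)%R by exact: powR_gt0.
have : hausdorff_measure s (f @` A) <= (L `^ s)%:E * hausdorff_measure s A.
  apply: hausdorff_measure_le => d d0; have dL : (0 < d / L)%R by exact: divr_gt0.
  rewrite -[d](divrK (_ : L \is a GRing.unit)) ?unitf_gt0// mulrC.
  apply: le_trans (hausdorff_content_lipschitz_image _ _ _ s0) _.
  by rewrite lee_pmul2l// hausdorff_content_le_measure.
by rewrite fAs; exact: pinfty_le_pmul.
Qed.

End lipschitz.

(** * Maps with few pieces in the fibres at each scale *)

(** Linear growth is absorbed by any exponential growth. *)
Lemma linear_le_exponential {R : realType} (b : R) : 1 < b ->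
  exists2 C : R, 0 < C & forall n, n.+1%:R <= C * b ^+ n.
Proof.
move=> b1; have h0 : 0 < b - 1 by rewrite subr_gt0.
have bernoulli n : 1 + (b - 1) * n%:R <= b ^+ n.
  elim: n => [|n IHn]; first by rewrite mulr0 addr0 expr0.
  rewrite exprS -natr1; have n0 : 0 <= n%:R :> R by [].
  have : b * (1 + (b - 1) * n%:R) <= b * b ^+ n by rewrite ler_wpM2l//; lra.
  apply: le_trans; have : 0 <= (b - 1) * (b - 1) * n%:R by rewrite !mulr_ge0// ltW.
  lra.
have hV0 : 0 < (b - 1)^-1 by rewrite invr_gt0.
exists (1 + (b - 1)^-1) => [|n]; first by rewrite addr_gt0.
have C0 : 0 <= 1 + (b - 1)^-1 by rewrite addr_ge0// ltW.
apply: le_trans (ler_wpM2l C0 (bernoulli n)).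
rewrite -natr1 mulrDr mulr1 mulrDl mul1r mulrA mulVf ?gt_eqF// mul1r.
have := mulr_ge0 (ltW h0) (ler0n R n); lra.
Qed.

Section subexponential_fibres.
Context {R : realType} (b : R).
Context (b_gt1 : 1 < b).
Let b_gt0 : 0 < b. Proof. exact: lt_trans b_gt1. Qed.

Lemma powR_exprVn s n : (b ^- n) `^ s = ((b `^ s) ^+ n)^-1.
Proof.
rewrite -powR_invn ?ltW// -powRrM -powR_mulrn ?powR_ge0// -powRrM -powRN.
by congr (_ `^ _); ring.
Qed.

Lemma exprVn_gt0 n : 0 < b ^- n.
Proof. by rewrite invr_gt0 exprn_gt0. Qed.

Lemma exprVn_small d : 0 < d -> exists n, b ^- n < d.
Proof.
move=> d0; have [C C0 CP] := linear_le_exponential _ b_gt1.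
exists (Num.bound (C / d)); set n := Num.bound _.
rewrite invf_plt ?posrE ?exprn_gt0//.
have : C / d < n.+1%:R.
  by apply: lt_trans (archi_boundP _) _; rewrite ?ltr_nat// divr_ge0 ?ltW.
by move=> /lt_le_trans/(_ (CP n)); rewrite ltr_pM2l.
Qed.

Lemma linear_powR_exprVn_le u : 0 < u ->
  exists2 C : R, 0 < C & forall n, n.+1%:R * (b ^- n) `^ u <= C.
Proof.
move=> u0; have bu1 : 1 < b `^ u.
  by have := @gt0_ltr_powR R u u0 1 b; rewrite powR1; apply; rewrite ?nnegrE// ltW.
have [C C0 CP] := linear_le_exponential _ bu1; exists C => // n.
by rewrite powR_exprVn ler_pdivrMr// exprn_gt0// powR_gt0.
Qed.

Lemma linear_powR_exprVn_small t m e : 0 < t -> 0 < e ->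
  exists2 n, (m <= n)%N & n.+1%:R * (b ^- n) `^ t <= e.
Proof.
move=> t0 e0; have [|C C0 CP] := linear_powR_exprVn_le (t / 2); first lra.
pose N := Num.bound (C * C / e); exists (m + N)%N; first exact: leq_addr.
set n := (m + N)%N; have n0 : 0 < n.+1%:R :> R by [].
(* Writing p for (b ^- n) `^ (t / 2), the product (n + 1) p^2 is
   ((n + 1) p)^2 / (n + 1). *)
rewrite -(ler_pM2l n0) [t]splitr powRD; last by rewrite (gt_eqF (exprVn_gt0 n)) implybT.
have -> : n.+1%:R * (n.+1%:R * ((b ^- n) `^ (t / 2) * (b ^- n) `^ (t / 2))) =
  (n.+1%:R * (b ^- n) `^ (t / 2)) * (n.+1%:R * (b ^- n) `^ (t / 2)) by ring.
have p0 : 0 <= n.+1%:R * (b ^- n) `^ (t / 2) by rewrite mulr_ge0// powR_ge0.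
apply: le_trans (ler_pM p0 p0 (CP n) (CP n)) _.
rewrite -ler_pdivrMr//; have CCe : 0 <= C * C / e.
  by rewrite divr_ge0 ?mulr_ge0// ltW.
apply: ltW; apply: lt_le_trans (archi_boundP CCe) _.
by rewrite ler_nat leqW// leq_addl.
Qed.

Context {X Y : metricType R} (f : X -> Y) (K : nat).
(* Only the sets [V j] with [j < K * (n + 1)] take part in the covering. *)
Context (f_fibres : forall n (U : set Y), (diam U <= (b ^- n)%:E)%E ->
  exists V : nat -> set X, f @^-1` U `<=` \bigcup_(j in `I_(K * n.+1)) V j /\
    forall j, (diam (V j) <= (b ^- n)%:E)%E).
Implicit Types (A : set X) (U : set Y) (s t d e : R).
Local Open Scope ereal_scope.

(** The scale [n] at which the preimage of [U] is cut. If [U] has positive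
    diameter, [n] is the largest scale with [diam U <= b ^- n]. If [U] has diameter
    0 there is none, and [n] is taken so large that the cost is below [e]. *)
Lemma fibre_scale s t : (0 <= s)%R -> (s < t)%R ->
  exists2 C : R, (0 < C)%R & forall m e U, (0 < e)%R -> diam U <= (b ^- m)%:E ->
    exists n, [/\ (m <= n)%N, diam U <= (b ^- n)%:E &
      ((K * n.+1)%:R * (b ^- n) `^ t)%:E <= C%:E * diam_pow s U + e%:E].
Proof.
move=> s0 st; have [|C C0 CP] := linear_powR_exprVn_le (t - s)%R.
  by rewrite subr_gt0.
have t0 : (0 < t)%R by exact: le_lt_trans st.
have bs0 : (0 < b `^ s)%R by exact: powR_gt0.
exists (K.+1%:R * C * b `^ s)%R; first by rewrite !mulr_gt0.
move=> m e U e0 Um.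
have Ufin : diam U \is a fin_num.
  by rewrite ge0_fin_numE ?diam_ge0// (le_lt_trans Um)// ltry.
have [r Ur] : exists r, diam U = r%:E by exists (fine (diam U)); rewrite fineK.
have := diam_ge0 U; rewrite Ur lee_fin le_eqVlt => /predU1P[r0|r0].
  have eK0 : (0 < e / K.+1%:R)%R by rewrite divr_gt0.
  have [n mn nP] := linear_powR_exprVn_small _ m _ t0 eK0.
  exists n; split => //; first by rewrite -r0 lee_fin ltW// exprVn_gt0.
  apply: (@le_trans _ _ e%:E); last first.
    rewrite leeDr// mule_ge0 ?diam_pow_ge0// lee_fin !mulr_ge0// ltW//.
  rewrite lee_fin natrM -mulrA; move: nP; rewrite ler_pdivlMr//; apply: le_trans.
  by rewrite mulrC ler_wpM2l ?mulr_ge0 ?powR_ge0// ler_nat.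
have ex_n : exists n, (b ^- n.+1 < r)%R.
  have [n nr] := exprVn_small _ r0; exists n; apply: lt_trans nr.
  by rewrite ltf_pV2 ?posrE ?exprn_gt0// ltr_eXn2l.
case: (ex_minnP ex_n) => n nr n_min.
have mn : (m <= n)%N.
  rewrite leqNgt; apply/negP => nm; move: Um; rewrite Ur lee_fin leNgt => /negP; apply.
  by apply: le_lt_trans nr; rewrite lef_pV2 ?posrE ?exprn_gt0// ler_weXn2l// ltW.
have rn : (r <= b ^- n)%R.
  case: n n_min mn nr => [|n] n_min mn nr.
    by move: mn Um; rewrite leqn0 => /eqP ->; rewrite Ur lee_fin.
  by rewrite leNgt; apply/negP => /n_min; rewrite ltnn.
exists n; split => //; apply: (@le_trans _ _ ((K.+1%:R * C * b `^ s)%:E * diam_pow s U)).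
  have -> : diam_pow s U = (r `^ s)%:E.
    rewrite /diam_pow ifF ?Ur//; apply/eqP => U0.
    by move: Ur r0; rewrite U0 diam0 => -[<-]; rewrite ltxx.
  rewrite -EFinM lee_fin natrM -mulrA.
  have -> : ((b ^- n) `^ t = (b ^- n) `^ (t - s) * (b ^- n) `^ s)%R.
    rewrite -powRD ?subrK//; first by rewrite (gt_eqF (exprVn_gt0 n)) implybT.
  have brs : ((b ^- n) `^ s <= b `^ s * r `^ s)%R.
    rewrite -powRM ?(ltW b_gt0) ?(ltW r0)//; apply: ge0_ler_powR => //; rewrite ?nnegrE.
    - exact: ltW (exprVn_gt0 n).
    - by rewrite mulr_ge0// ltW.
    - move: nr; rewrite exprS invfM mulrC ltr_pdivrMr// mulrC; exact: ltW.
  rewrite -(mulrA _ (b `^ s)%R) -(mulrA K.+1%:R).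
  apply: ler_pM => //.
  - by rewrite !mulr_ge0// powR_ge0.
  - by rewrite ler_nat.
  - rewrite mulrA; apply: ler_pM => //; rewrite ?mulr_ge0// ?powR_ge0//.
by rewrite leeDl// lee_fin ltW.
Qed.

Lemma hausdorff_content_fibres s t : (0 <= s)%R -> (s < t)%R ->
  exists2 C : R, (0 < C)%R & forall m A,
    hausdorff_content t (b ^- m) A <= C%:E * hausdorff_content s (b ^- m) (f @` A).
Proof.
move=> s0 st; have [C C0 CP] := fibre_scale s t s0 st; exists C => // m A.
have t0 : (0 <= t)%R by exact: le_trans (ltW st).
rewrite -lee_pdivrMl//; apply: le_ereal_inf_tmp => _ /= [U [AU Ud] <-].
rewrite lee_pdivrMl//; apply/lee_addgt0Pr => e e0.
have ei i : (0 < e / (2 ^ i.+1)%:R)%R by rewrite divr_gt0// ltr0n expn_gt0.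
have [n nP] := choice (fun i => CP m _ _ (ei i) (Ud i)).
have /choice[V VP] : forall i, exists V : nat -> set X,
    f @^-1` (U i) `<=` \bigcup_(j in `I_(K * (n i).+1)) V j /\
    forall j, (diam (V j) <= (b ^- n i)%:E)%E.
  by move=> i; apply: f_fibres; have [] := nP i.
pose W i j := if (j < K * (n i).+1)%N then V i j else set0.
apply: (@le_trans _ _ (\sum_(0 <= i <oo) \sum_(0 <= j <oo) diam_pow t (W i j))).
  apply: hausdorff_content_le_double => [x Ax|i j].
    have [i _ Ufx] : (\bigcup_i U i) (f x) by apply: AU; exists x.
    have [j jK Vx] := (VP i).1 x Ufx; exists i => //; exists j => //.
    by rewrite /W jK.
  have [mn _ _] := nP i; rewrite /W; case: ifP => _; last first.
    by rewrite diam0 lee_fin ltW// exprVn_gt0.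
  apply: le_trans ((VP i).2 j) _; rewrite lee_fin.
  by rewrite lef_pV2 ?posrE ?exprn_gt0// ler_weXn2l// ltW.
rewrite -nneseriesZl; last by move=> i _; exact: diam_pow_ge0.
apply: le_trans (epsilon_trick _ _ (ltW e0)); last first.
  by move=> i; rewrite mule_ge0 ?diam_pow_ge0// lee_fin ltW.
apply: lee_nneseries => [i _ _|i _].
  by apply: nneseries_ge0 => j _ _; exact: diam_pow_ge0.
have [_ _] := nP i; apply: le_trans.
rewrite (nneseries_split 0 (K * (n i).+1)); last by move=> j _; exact: diam_pow_ge0.
rewrite add0n [X in _ + X]eseries0 => [|j jK _]; last first.
  by rewrite /W ltnNge jK/= diam_pow0.
rewrite adde0; apply: le_trans (_ : \sum_(0 <= j < K * (n i).+1) ((b ^- n i) `^ t)%:E <= _).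
  rewrite big_seq [leRHS]big_seq; apply: lee_sum => j.
  rewrite mem_index_iota => /andP[_ jK]; rewrite /W jK.
  exact: diam_pow_le ((VP i).2 j).
by rewrite sumEFin big_const_nat subn0 iter_addr_0 lee_fin mulr_natl.
Qed.

(** When the preimage of each set of diameter at most [b ^- n] splits into at most
    [K * (n + 1)] pieces of diameter at most [b ^- n], taking images does not
    decrease the dimension. *)
Lemma hausdorff_dim_fibres A : hausdorff_dim A <= hausdorff_dim (f @` A).
Proof.
apply: hausdorff_dim_le (hausdorff_dim_ge0 _) _ => t t0 At.
apply/lee_subgt0Pr => e e0.
have [te|et] := ltP (t - e)%R 0%R.
  by apply: le_trans (hausdorff_dim_ge0 _); rewrite lee_fin ltW.
apply: le_hausdorff_dim => //.
have [|C C0 CP] := hausdorff_content_fibres _ t et; first by rewrite gtrBl.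
apply: (pinfty_le_pmul _ _ C0); rewrite -At; apply: hausdorff_measure_le => d d0.
have [m /ltW md] := exprVn_small _ d0.
apply: le_trans (hausdorff_content_nonincreasing _ _ _ _ md) _.
apply: le_trans (CP m A) _.
by rewrite lee_pmul2l// hausdorff_content_le_measure// exprVn_gt0.
Qed.

End subexponential_fibres.

(** * Prefixes of greedy expansions *)

Section greedy_expansion.
Context {R : realType} (beta : R).
Context (beta_gt1 : 1 < beta).
Let beta_gt0 : 0 < beta. Proof. exact: lt_trans beta_gt1. Qed.
Implicit Types x a : R.

Lemma beta_transformation_itv x : 0 <= beta_transformation beta x < 1.
Proof.
have /andP[mx xm] := real_floor_itv (num_real (beta * x)).
by move: xm; rewrite intrD /beta_transformation subr_ge0 mx/= ltrBlDl.
Qed.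

Lemma beta_digitS x k :
  beta_digit beta x k.+1 = beta_digit beta (beta_transformation beta x) k.
Proof. by rewrite /beta_digit iterSr. Qed.

Lemma beta_digit_small x n : 0 <= x < beta ^- n ->
  forall k, (k < n)%N -> beta_digit beta x k = 0.
Proof.
elim: n x => [//|n IHn] x /andP[x0 xn].
have bx0 : 0 <= beta * x by rewrite mulr_ge0// ltW.
have bxn : beta * x < beta ^- n.
  by move: xn; rewrite exprS invfM ltr_pdivlMl.
have fl0 : Num.floor (beta * x) = 0.
  apply/eqP; rewrite floor_eq bx0/= add0r; apply: lt_le_trans bxn _.
  by rewrite invf_le1 ?exprn_gt0// exprn_ege1// ltW.
case=> [_|k kn]; first by rewrite /beta_digit.
rewrite beta_digitS; apply: IHn => //.
by rewrite /beta_transformation fl0 subr0 bx0.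
Qed.

(** The points of a half-open window of length [beta ^- n] have at most [n + 1]
    different [n]-prefixes. For [n >= 1], the map [x |-> beta * x] sends the
    window starting at [a] to one of length [beta ^- (n - 1)]. With [m] the floor
    of [beta * a], the points sent below [m + 1] have first digit [m] and are
    mapped by the beta-transformation into one window of length
    [beta ^- (n - 1)]; the others have first digit [m + 1] and are mapped into
    [0, beta ^- (n - 1)[, so that their next [n - 1] digits are zero. *)
Lemma beta_digit_words n a : exists W : nat -> nat -> int,
  forall x, 0 <= x < 1 -> a <= x < a + beta ^- n ->
    exists2 i, (i <= n)%N & forall k, (k < n)%N -> beta_digit beta x k = W i k.
Proof.
elim: n a => [|n IHn] a; first by exists (fun _ _ => 0) => x _ _; exists 0%N.
pose m := Num.floor (beta * a); have [W WP] := IHn (beta * a - m%:~R).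
exists (fun i k => match i, k with
  | 0, 0 => m + 1 | 0, _ => 0 | _, 0 => m | j.+1, l.+1 => W j l end).
move=> x _ /andP[ax xa].
have /andP[ma am] : m%:~R <= beta * a < (m + 1)%:~R.
  exact: real_floor_itv (num_real _).
have bax : beta * a <= beta * x by rewrite ler_pM2l.
have bxa : beta * x < beta * a + beta ^- n.
  move: xa; rewrite -(ltr_pM2l beta_gt0) mulrDr exprS invfM mulrA mulfV ?gt_eqF//.
  by rewrite mul1r.
have [xm|mx] := ltP (beta * x) (m + 1)%:~R.
  have flx : Num.floor (beta * x) = m.
    by apply/eqP; rewrite floor_eq (le_trans ma bax)/=.
  have [|i ni iP] := WP _ (beta_transformation_itv x).
    by rewrite /beta_transformation flx lerB//=; lra.
  exists i.+1 => // -[_|k kn]; first by rewrite /beta_digit.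
  by rewrite beta_digitS iP.
have bn1 : beta ^- n <= 1 by rewrite invf_le1 ?exprn_gt0// exprn_ege1// ltW.
have flx : Num.floor (beta * x) = m + 1.
  by apply/eqP; rewrite floor_eq mx/= intrD mulr1z; lra.
exists 0%N => // -[_|k kn]; first by rewrite /beta_digit.
rewrite beta_digitS; apply: (beta_digit_small _ n _ k kn).
rewrite /beta_transformation flx subr_ge0 mx/=; lra.
Qed.

Lemma beta_expansion_prefix x n :
  x = \sum_(0 <= k < n) (beta_digit beta x k)%:~R * beta ^- k.+1 +
      beta ^- n * iter n (beta_transformation beta) x.
Proof.
elim: n => [|n {1}->]; first by rewrite big_nil expr0 invr1 mul1r add0r.
rewrite big_nat_recr//= -addrA; congr (_ + _).
rewrite /beta_transformation /beta_digit exprS; field.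
by rewrite (gt_eqF beta_gt0) expf_neq0// gt_eqF.
Qed.

End greedy_expansion.

(** * The natural projection *)

Section projection.
Context {R : realType} {beta : R} (beta_gt1 : 1 < beta).
Let beta_gt0 : 0 < beta. Proof. exact: lt_trans beta_gt1. Qed.
Implicit Types (w v : digit_seq beta_gt1) (n k : nat).

Lemma digit_dist_le w v n :
  (forall k, (k < n)%N -> w k = v k) -> digit_dist w v <= beta ^- n.
Proof.
move=> wv; rewrite /digit_dist; case: pselect => [ex|nex]; last first.
  by rewrite invr_ge0 exprn_ge0// ltW.
case: ex_minnP => m wvm _; rewrite lef_pV2 ?posrE ?exprn_gt0// ler_weXn2l// ?ltW//.
by rewrite leqNgt; apply/negP => /wv/eqP; rewrite (negbTE wvm).
Qed.

Lemma digit_dist_lt w v n : digit_dist w v < beta ^- n ->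
  forall k, (k <= n)%N -> w k = v k.
Proof.
rewrite /digit_dist; case: pselect => [ex|nex] h k kn; last first.
  by apply/eqP/negPn/negP => wvk; apply: nex; exists k.
move: h; case: ex_minnP => m _ m_min.
rewrite ltf_pV2 ?posrE ?exprn_gt0// ltr_eXn2l// => nm.
by apply/eqP/negPn/negP => /m_min; rewrite leqNgt (leq_ltn_trans kn).
Qed.

(** The partial sums of the series defining the projection. *)
Definition prefix_value w n : R :=
  \sum_(0 <= k < n) (w k : nat)%:R * beta ^- k.+1.

(** The sum of the [N * beta ^- n] for [n >= 1], where [N] is the size of the
    alphabet, hence an upper bound of the value of any digit sequence. *)
Definition tail_const : R := `|Num.ceil beta|%N%:R / (beta - 1).

Lemma tail_const_ge0 : 0 <= tail_const.
Proof. by rewrite /tail_const divr_ge0// subr_ge0 ltW. Qed.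

Lemma prefix_value_nondecreasing w : nondecreasing_seq (prefix_value w).
Proof.
apply/nondecreasing_seqP => n; rewrite /prefix_value big_nat_recr//= lerDl.
by rewrite mulr_ge0// invr_ge0 exprn_ge0// ltW.
Qed.

Lemma prefix_value_tail_nonincreasing w :
  nonincreasing_seq (fun n => prefix_value w n + tail_const * beta ^- n).
Proof.
apply/nonincreasing_seqP => n; rewrite /prefix_value big_nat_recr//= -addrA lerD2l.
have b1 : beta - 1 != 0 by rewrite gt_eqF// subr_gt0.
have -> : tail_const * beta ^- n =
    `|Num.ceil beta|%N%:R * beta ^- n.+1 + tail_const * beta ^- n.+1.
  rewrite /tail_const exprS; field.
  by rewrite b1 (gt_eqF beta_gt0) expf_neq0// gt_eqF.
by rewrite lerD2r ler_wpM2r ?invr_ge0 ?exprn_ge0 ?ltW// ltr_nat.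
Qed.

(** The projection lies between the partial sums and their upper estimates, two
    monotone sequences. *)
Lemma prefix_value_pi (w : S_beta beta_gt1) n :
  prefix_value (val w) n <= pi_beta beta_gt1 w <=
    prefix_value (val w) n + tail_const * beta ^- n.
Proof.
have ub k : prefix_value (val w) k <= tail_const.
  have := prefix_value_tail_nonincreasing (val w) 0%N k (leq0n k).
  rewrite {2}/prefix_value big_nil add0r expr0 invr1 mulr1.
  by apply: le_trans; rewrite lerDl mulr_ge0 ?tail_const_ge0// invr_ge0 exprn_ge0// ltW.
have cv : cvgn (prefix_value (val w)).
  apply: nondecreasing_is_cvgn; first exact: prefix_value_nondecreasing.
  by exists tail_const => _ [k _ <-].
apply/andP; split.
  exact: (nondecreasing_cvgn_le (@prefix_value_nondecreasing (val w)) cv n).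
apply: limr_le => //; exists n => // k /= nk.
apply: le_trans (@prefix_value_tail_nonincreasing (val w) n k nk).
by rewrite lerDl mulr_ge0 ?tail_const_ge0// invr_ge0 exprn_ge0// ltW.
Qed.

Lemma prefix_value_eq w v n : (forall k, (k < n)%N -> w k = v k) ->
  prefix_value w n = prefix_value v n.
Proof. by move=> wv; apply: eq_big_nat => k /andP[_ kn]; rewrite wv. Qed.

Lemma pi_beta_lipschitz (w v : S_beta beta_gt1) :
  mdist (pi_beta beta_gt1 w) (pi_beta beta_gt1 v) <= (tail_const + 1) * mdist w v.
Proof.
have C0 := tail_const_ge0.
pose p : R := pi_beta beta_gt1 w; pose q : R := pi_beta beta_gt1 v.
suff : `|q - p| <= (tail_const + 1) * digit_dist (val w) (val v) by [].
suff key n : (forall k, (k < n)%N -> val w k = val v k) ->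
    `|q - p| <= (tail_const + 1) * beta ^- n.
  rewrite /digit_dist; case: pselect => [ex|nex].
    case: ex_minnP => m _ m_min; apply: key => k km.
    by apply/eqP/negPn/negP => /m_min; rewrite leqNgt km.
  have wv : w = v.
    apply/val_inj/funext => k.
    by apply/eqP/negPn/negP => wvk; apply: nex; exists k.
  by rewrite /q /p wv subrr normr0 mulr0.
move=> wv; have := prefix_value_pi w n; have := prefix_value_pi v n.
rewrite -/p -/q (prefix_value_eq _ _ _ wv).
have : 0 <= beta ^- n by rewrite invr_ge0 exprn_ge0// ltW.
rewrite ler_norml mulrDl mul1r => bn /andP[h1 h2] /andP[h3 h4].
apply/andP; split; lra.
Qed.

(** A sequence of [S_beta] shares its [n]-prefix with an expansion, of a point
    close to its projection. *)
Lemma S_beta_approx (w : S_beta beta_gt1) n : exists x : R,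
  [/\ 0 <= x < 1, `|x - pi_beta beta_gt1 w| <= (tail_const + 1) * beta ^- n &
    forall k, (k < n)%N -> beta_digit beta x k = (val w k : nat)%:Z].
Proof.
have bn : 0 < beta ^- n by rewrite invr_gt0 exprn_gt0.
have wS : closure (Sigma_beta beta_gt1) (val w) by exact: set_valP.
have [v [[x [x01 xv]]]] := wS _ (nbhsx_ballx _ _ bn).
rewrite ballEmdist => /(digit_dist_lt (val w) v) wv; exists x.
have wv' k : (k < n)%N -> val w k = v k by move=> kn; apply: wv; exact: ltnW.
split => //; last by move=> k kn; rewrite xv wv'.
have := prefix_value_pi w n; rewrite (prefix_value_eq _ _ _ wv').
have := beta_expansion_prefix beta beta_gt1 x n.
have -> : \sum_(0 <= k < n) (beta_digit beta x k)%:~R * beta ^- k.+1 = prefix_value v n.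
  by apply: eq_bigr => k _; rewrite xv.
have : 0 <= iter n (beta_transformation beta) x <= 1.
  case: n {bn wv wv'} => [|n /=]; first by have /andP[-> /ltW ->] := x01.
  by have /andP[-> /ltW ->] := beta_transformation_itv beta
    (iter n (beta_transformation beta) x).
move: (iter _ _ _) => y /andP[y0 y1] ->; rewrite ler_norml mulrDl mul1r => /andP[h3 h4].
have h1 : 0 <= beta ^- n * y by rewrite mulr_ge0// ltW.
have h2 : beta ^- n * y <= beta ^- n by rewrite ler_piMr// ltW.
have := mulr_ge0 tail_const_ge0 (ltW bn) => h5.
apply/andP; split; lra.
Qed.

(** The preimage of a set of diameter at most [beta ^- n] is covered by at most
    [K * (n + 1)] cylinders of order [n]. *)
Lemma pi_beta_fibres : exists K, forall n (U : set R^o),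
  (diam U <= (beta ^- n)%:E)%E -> exists V : nat -> set (S_beta beta_gt1),
    pi_beta beta_gt1 @^-1` U `<=` \bigcup_(j in `I_(K * n.+1)) V j /\
    forall j, (diam (V j) <= (beta ^- n)%:E)%E.
Proof.
pose K0 := Num.bound (tail_const + 2); exists (2 * K0)%N => n U Un.
have bn : 0 < beta ^- n by rewrite invr_gt0 exprn_gt0.
have [->|/set0P U0] := eqVneq U set0.
  exists (fun=> set0); split => [w|_]; first by rewrite preimage_set0.
  by rewrite diam0 lee_fin ltW.
have [u Uu] : exists u : R, U u by exact: U0.
(* The windows [l < 2 * K0] tile the interval centred at [u] with half-length
   [K0 * beta ^- n]. *)
have /choice[W WP] l := beta_digit_words beta beta_gt1 n
  (u + (l%:R - K0%:R) * beta ^- n).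
(* The cylinder with index [l * (n + 1) + i] is given by the [i]-th prefix of
   window [l]. *)
exists (fun j => [set w : S_beta beta_gt1 | forall k, (k < n)%N ->
  (val w k : nat)%:Z = W (j %/ n.+1)%N (j %% n.+1)%N k]); split => [w Uw|j].
  have [x [x01 xw xk]] := S_beta_approx w n.
  pose p : R := pi_beta beta_gt1 w; rewrite -/p in xw.
  have uw : `|p - u| <= beta ^- n.
    by have := mdist_le_diam _ _ _ Uu Uw => /le_trans/(_ Un); rewrite lee_fin.
  have K0P : tail_const + 2 < K0%:R.
    by apply: archi_boundP; have := tail_const_ge0; lra.
  pose y := (x - u) / beta ^- n + K0%:R.
  have xE : x = u + (y - K0%:R) * beta ^- n.
    by rewrite /y addrK divfK ?gt_eqF// addrC subrK.
  have : `|(x - u) / beta ^- n| < K0%:R.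
    rewrite normrM normfV (gtr0_norm bn) ltr_pdivrMr//.
    apply: (@le_lt_trans _ _ ((tail_const + 2) * beta ^- n)); last by rewrite ltr_pM2r.
    rewrite -(subrKA p); apply: le_trans (ler_normD _ _) _.
    by move: xw uw; rewrite !mulrDl mul1r; lra.
  rewrite ltr_norml => /andP[y1 y2].
  have y0 : 0 <= y by rewrite /y; lra.
  have /andP[ly yl] := truncn_itv y0.
  set l := Num.truncn y in ly yl.
  have lK : (l < 2 * K0)%N.
    by rewrite -(ltr_nat R) natrM; apply: le_lt_trans ly _; rewrite /y; lra.
  have [|i ni iP] := WP l x x01.
    have h1 : (l%:R - K0%:R) * beta ^- n <= (y - K0%:R) * beta ^- n.
      by rewrite ler_pM2r// lerD2r.
    have h2 : (y - K0%:R) * beta ^- n < (l%:R + 1 - K0%:R) * beta ^- n.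
      by rewrite ltr_pM2r// ltrD2r natr1.
    by apply/andP; split; lra.
  exists (l * n.+1 + i)%N => /=.
    by apply: (@leq_trans (l * n.+1 + n.+1)); rewrite ?ltn_add2l// -mulSnr leq_mul2r lK orbT.
  by move=> k kn; rewrite divnMDl// divn_small// addn0 modnMDl modn_small// -xk// iP.
apply: diam_le => [|w v wW vW]; first by rewrite lee_fin ltW.
rewrite lee_fin; apply: digit_dist_le => k kn.
by apply/val_inj; have := wW k kn; rewrite -(vW k kn) => -[].
Qed.

End projection.

Theorem theorem1p1 (R : realType) (beta : R) (beta_gt1 : 1 < beta)
    (Z : set (S_beta beta_gt1)) :
  hausdorff_dim Z = hausdorff_dim (pi_beta beta_gt1 @` Z).
Proof.
apply/eqP; rewrite eq_le; apply/andP; split.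
  have [K KP] := pi_beta_fibres beta_gt1.
  exact: (hausdorff_dim_fibres beta beta_gt1 _ K KP).
apply: (hausdorff_dim_lipschitz_image _ (tail_const (beta := beta) + 1)).
  by rewrite ltr_wpDl// tail_const_ge0.
exact: pi_beta_lipschitz.
Qed.
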